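(* Let $M,N\in\mathcal{LC}$ with $M_j\le N_j$ for all $j\in\mathbb{N}$, and let $\omega_M,\omega_N$ be the corresponding associated weight functions. Then $$\alpha(N,\Omega_M)=\frac{1}{\beta(\omega_N,\omega_M)}.$$
   Context: $\mathbb{N}=\{0,1,2,\dots\}$. $\mathcal{LC}$ is the set of sequences $M=(M_j)_{j\in\mathbb{N}}$ of positive reals with $1=M_0\le M_1$, $M_j^2\le M_{j-1}M_{j+1}$ for $j\ge1$, and $\lim_j(M_j)^{1/j}=+\infty$. For $M\in\mathcal{LC}$: $\omega_M(t)=\sup_{j\in\mathbb{N}}\log(t^j/M_j)$ for $t>0$, $\omega_M(0)=0$; $\varphi_{\omega_M}(y)=\omega_M(e^y)$; $\varphi^*_{\omega_M}(x)=\sup_{y\ge0}\{xy-\varphi_{\omega_M}(y)\}$ for $x\ge0$. $\Omega_M=\{W^q:q>0\}$ with $W^q_j=\exp(\frac1q\varphi^*_{\omega_M}(qj))$ is the weight matrix associated with $\omega_M$. For $M,N\in\mathcal{LC}$ with $M\le N$, $\alpha(N,\Omega_M)\in[0,\infty]$ is the infimum of all $a>0$ such that $$\exists q>1:\ \limsup_{j\to+\infty}\frac{\exp(\frac1{jq}\varphi^*_{\omega_M}(jq))}{\exp(\frac1j\varphi^*_{\omega_N}(j))}<q^a$$ ($j$ running over positive integers; equivalently $\limsup_j(W^q_j/N_j)^{1/j}<q^a$), with value $\infty$ if no such $a$ exists. For weight functions $\sigma\ge\omega$ (continuous, nondecreasing on $[0,\infty)$, vanishing at $0$, tending to $+\infty$),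 $\beta(\omega,\sigma)\in[0,\infty]$ is the supremum of all $b>0$ such that $$\exists K>1:\ \liminf_{t\to+\infty}\frac{\sigma(Kt)}{\omega(t)}>K^b,$$ with value $0$ if no such $b$ exists. Conventions: $1/0=\infty$, $1/\infty=0$. *)

(* Defs.v *)
From HB Require Import structures.
From mathcomp Require Import all_boot all_order all_algebra.
From mathcomp Require Import all_classical all_reals all_analysis.

Set Implicit Arguments.
Unset Strict Implicit.
Unset Printing Implicit Defensive.

Import Order.TTheory GRing.Theory Num.Theory.
Import numFieldNormedType.Exports.

Local Open Scope classical_set_scope.
Local Open Scope ring_scope.

(** The class $\mathcal{LC}$. *)
Record is_LC (R : realType) (M : nat -> R) : Prop := IsLC {
  LC_gt0 : forall j, 0 < M j ;
  LC_M0 : M 0%N = 1 ;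
  LC_M1 : 1 <= M 1%N ;
  LC_logconvex : forall j, (1 <= j)%N -> M j ^+ 2 <= M j.-1 * M j.+1 ;
  LC_root : (fun j : nat => M j `^ (j%:R)^-1) @ \oo --> +oo
}.

(** $\omega_M$. The supremum is that of a nonempty bounded set
    ([has_sup_assoc_weight]). Only nonnegative arguments matter. *)
Definition assoc_weight (R : realType) (M : nat -> R) (t : R) : R :=
  if 0 < t then sup [set ln (t ^+ j / M j) | j in [set: nat]] else 0.

Definition phi (R : realType) (w : R -> R) (y : R) : R := w (expR y).

(** $\varphi_\omega^*$. For $\omega = \omega_M$ and [0 <= x] the supremum is that
    of a nonempty bounded set ([has_sup_phi_conj]). *)
Definition phi_conj (R : realType) (w : R -> R) (x : R) : R :=
  sup [set x * y - phi w y | y in [set y : R | 0 <= y]].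

(** The ratio below is $(W^q_j / N_j)^{1/j}$, where
    $W^q_j = \exp(\varphi_{\omega_M}^*(qj)/q)$ runs through the weight matrix
    $\Omega_M$. The term of index [j = 0] is irrelevant for the upper limit. *)
Definition alpha_ratio (R : realType) (N M : nat -> R) (q : R) (j : nat) : R :=
  expR ((j%:R * q)^-1 * phi_conj (assoc_weight M) (j%:R * q)) /
  expR ((j%:R)^-1 * phi_conj (assoc_weight N) j%:R).

(** $\alpha(N, \Omega_M)$; recall [ereal_inf set0 = +oo]. *)
Definition alpha_index (R : realType) (N M : nat -> R) : \bar R :=
  ereal_inf [set a%:E | a in [set a : R | 0 < a /\
    exists q : R, 1 < q /\
      (limn_esup (fun j => (alpha_ratio N M q j)%:E) < (q `^ a)%:E)%E]].

(** $\beta(\omega, \sigma)$. Since [ereal_sup set0 = -oo], the maximum with 0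
    yields the value 0 when no [b] is admissible and changes nothing
    otherwise. *)
Definition beta_index (R : realType) (w s : R -> R) : \bar R :=
  maxe 0%E (ereal_sup [set b%:E | b in [set b : R | 0 < b /\
    exists K : R, 1 < K /\
      ((K `^ b)%:E < limf_einf (fun t : R => (s (K * t) / w t)%:E) +oo%R)%E]]).

Lemma has_sup_assoc_weight (R : realType) (M : nat -> R) (t : R) :
  is_LC M -> 0 < t -> has_sup [set ln (t ^+ j / M j) | j in [set: nat]].
Proof.
move=> LM t0; split; first by exists (ln (t ^+ 0 / M 0%N)), 0%N.
have /cvgryPge/(_ t)[J _ HJ] := LC_root LM.
exists (\sum_(i < J.+1) `|ln (t ^+ i / M i)|) => _ [j _ <-].
have [jJ|Jj] := ltnP j J.+1.
  rewrite (bigD1 (Ordinal jJ)) //= (le_trans (ler_norm _))// lerDl.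
  by apply: sumr_ge0.
have := HJ j (ltnW Jj); rewrite /= => tM.
have j0 : (0 < j)%N by apply: leq_trans Jj.
have tjM : t ^+ j <= M j.
  have := lerXn2r j (ltW t0) (powR_ge0 _ _) tM.
  rewrite -[(M j `^ _) ^+ j]powR_mulrn ?powR_ge0// -powRrM mulVf.
    by rewrite powRr1 // ltW // LC_gt0.
  by rewrite pnatr_eq0 -lt0n.
apply: (@le_trans _ _ 0); last exact: sumr_ge0.
by rewrite ln_le0// ler_pdivrMr ?mul1r// LC_gt0.
Qed.

Lemma has_sup_phi_conj (R : realType) (M : nat -> R) (x : R) :
  is_LC M -> 0 <= x ->
  has_sup [set x * y - phi (assoc_weight M) y | y in [set y : R | 0 <= y]].
Proof.
move=> LM x0; split.
  by exists (x * 0 - phi (assoc_weight M) 0), 0 => //=.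
pose j := (Num.truncn x).+1.
have xj : x <= j%:R by rewrite ltW// truncnS_gt.
exists (ln (M j)) => _ [y /= y0 <-].
rewrite lerBlDr /phi /assoc_weight expR_gt0.
have e0 := expR_gt0 y.
have h : ln (expR y ^+ j / M j) <= sup [set ln (expR y ^+ k / M k) | k in [set: nat]].
  apply: sup_upper_bound; first exact: has_sup_assoc_weight.
  by exists j.
have Mj0 := LC_gt0 LM j.
have E : ln (expR y ^+ j / M j) = j%:R * y - ln (M j).
  rewrite lnM ?posrE ?invr_gt0 ?exprn_gt0// lnV ?posrE//.
  by rewrite lnXn// expRK mulr_natl.
have := lerD (lexx (ln (M j))) h.
apply: le_trans; rewrite E addrC subrK.
exact: ler_wpM2r.
Qed.

(* Main.v *)
Require Import Defs.
From mathcomp Require Import all_boot all_order all_algebra.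
From mathcomp Require Import all_classical all_reals all_analysis.
From mathcomp Require Import ring lra.

Import Order.TTheory GRing.Theory Num.Theory.
Import numFieldNormedType.Exports.
Local Open Scope ring_scope.

(** Write [phi_M y = omega_M (e^y)]. Up to epsilons, both indices express the
    same inequality, in conjugate variables. The bound
    [phi_M^* (jq) <= q phi_N^* (j) + jqk] for all large [j] says that the
    [limsup] is at most [e^k]; the bound [phi_M (y + k) >= q phi_N y] for all
    large [y] says that the [liminf] at [K = e^k] is at least [q]. Each
    implies the other by Young's inequality, and with [k = a log q] and
    [q = K^b] the exponents are related by [a = 1 / b]. *)

(** * Eventual bounds from upper and lower limits *)

Section Limits.
Local Open Scope ereal_scope.
Local Open Scope classical_set_scope.

Lemma near_lt_limf_einf (T : choiceType) (X : filteredType T) (R : realType)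
    (f : X -> \bar R) (F : set_system X) (l : \bar R) :
  Filter F -> l < limf_einf f F -> \forall x \near F, l < f x.
Proof.
move=> FF; rewrite limf_einfE => /ereal_sup_gt[_ [V FV <-] lV].
apply: filterS FV => x Vx; apply: lt_le_trans lV _.
by apply: ereal_inf_lbound; exists x.
Qed.

Lemma limf_einf_ge_near (T : choiceType) (X : filteredType T) (R : realType)
    (f : X -> \bar R) (F : set_system X) (l : \bar R) :
  (\forall x \near F, l <= f x) -> l <= limf_einf f F.
Proof.
move=> lf; rewrite limf_einfE.
apply: (@le_trans _ _ (ereal_inf (f @` [set x | l <= f x]))).
  by apply: le_ereal_inf_tmp => _ [x lfx <-].
by apply: ereal_sup_ubound; exists [set x | l <= f x].
Qed.

Lemma near_limf_esup_lt (T : choiceType) (X : filteredType T) (R : realType)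
    (f : X -> \bar R) (F : set_system X) (l : \bar R) :
  Filter F -> limf_esup f F < l -> \forall x \near F, f x < l.
Proof.
move=> FF; rewrite limf_esupE => /ereal_inf_lt[_ [V FV <-] Vl].
apply: filterS FV => x Vx; apply: le_lt_trans Vl.
by apply: ereal_sup_ubound; exists x.
Qed.

Lemma limf_esup_le_near (T : choiceType) (X : filteredType T) (R : realType)
    (f : X -> \bar R) (F : set_system X) (l : \bar R) :
  (\forall x \near F, f x <= l) -> limf_esup f F <= l.
Proof.
move=> lf; rewrite limf_esupE.
apply: (@le_trans _ _ (ereal_sup (f @` [set x | f x <= l]))).
  by apply: ereal_inf_lbound; exists [set x | f x <= l].
by apply: ge_ereal_sup => _ [x lfx <-].
Qed.

End Limits.

(** The substitution t = e^y, using e^y >= 1 + y. The threshold can be taken nonnegative, the range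
    in which [young_phi_conj] applies. *)
Lemma near_pinfty_expR (R : realType) (P : R -> Prop) :
  (\forall t \near +oo, P t) <->
  exists2 Y, 0 <= Y & forall y, Y <= y -> P (expR y).
Proof.
split=> [[A [_ PA]]|[Y _ PY]].
  exists `|A| => // y Ay; apply: PA.
  apply: lt_le_trans (expR_ge1Dx y).
  by have := ler_norm A; lra.
exists (expR Y); split; first exact: num_real.
move=> t /= Yt; have t0 : 0 < t by apply: lt_trans (expR_gt0 Y) Yt.
by rewrite -(@lnK _ t) ?posrE//; apply: PY; rewrite -ler_expR lnK ?posrE// ltW.
Qed.

(** * The associated weight in the variable log t, and its conjugate *)

Section AssociatedWeight.
Context {R : realType} {M : nat -> R}.
Hypothesis LM : is_LC M.
Local Notation phiM := (phi (assoc_weight M)).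
Local Notation phiM' := (phi_conj (assoc_weight M)).

(** Inductively M_{k+1}^2 <= M_k M_{k+2} <= M_{k+1} M_{k+2}; cancel M_{k+1} > 0. *)
Lemma LC_nondecreasing (i j : nat) : (i <= j)%N -> M i <= M j.
Proof.
apply: (homo_leq (@lexx _ R) (@le_trans _ R)).
elim=> [|k IHk]; first by rewrite (LC_M0 LM) (LC_M1 LM).
have M0 := LC_gt0 LM k.+1.
rewrite -(ler_pM2l M0) -expr2 (le_trans (LC_logconvex LM (ltn0Sn k)))//.
by rewrite ler_wpM2r// ltW// (LC_gt0 LM).
Qed.

Lemma ln_weight_term (j : nat) (y : R) :
  ln (expR y ^+ j / M j) = j%:R * y - ln (M j).
Proof.
have Mj0 := LC_gt0 LM j.
rewrite lnM ?posrE ?invr_gt0 ?exprn_gt0 ?expR_gt0// lnV ?posrE//.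
by rewrite lnXn ?expR_gt0// expRK mulr_natl.
Qed.

Lemma phi_assoc_ge (j : nat) (y : R) : j%:R * y - ln (M j) <= phiM y.
Proof.
rewrite /phi /assoc_weight expR_gt0 -ln_weight_term.
apply: sup_upper_bound; last by exists j.
by apply: has_sup_assoc_weight => //; exact: expR_gt0.
Qed.

Lemma phi_assoc_le (y b : R) :
  (forall j : nat, j%:R * y - ln (M j) <= b) -> phiM y <= b.
Proof.
move=> Hb; rewrite /phi /assoc_weight expR_gt0; apply: ge_sup.
  by exists (ln (expR y ^+ 0 / M 0%N)), 0%N.
by move=> _ [j _ <-]; rewrite ln_weight_term.
Qed.

(** The term of index 1 is already positive. This allows clearing the denominator in
    [beta_index]. *)
Lemma phi_assoc_gt0 (y : R) : ln (M 1%N) < y -> 0 < phiM y.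
Proof.
by move=> My; apply: lt_le_trans (phi_assoc_ge 1 y); rewrite mul1r subr_gt0.
Qed.

(* For [y >= ln (M J)] the [J]-th term of the supremum dominates all the
   previous ones. *)
Lemma phi_assoc_le_tail (J : nat) (y b : R) : 0 <= y -> ln (M J) <= y ->
  (forall j : nat, (J <= j)%N -> j%:R * y - ln (M j) <= b) -> phiM y <= b.
Proof.
move=> y0 MJy Hb; apply: phi_assoc_le => j.
have [/Hb//|jJ] := leqP J j.
have lnM0 : 0 <= ln (M j).
  by rewrite ln_ge0// -(LC_M0 LM) LC_nondecreasing.
apply: le_trans (Hb J (leqnn J)).
have : (j.+1%:R : R) <= J%:R by rewrite ler_nat.
rewrite -natr1 => /(ler_wpM2r y0); lra.
Qed.

Lemma young_phi_conj (x y : R) : 0 <= x -> 0 <= y -> x * y <= phiM' x + phiM y.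
Proof.
move=> x0 y0; rewrite -lerBlDr; apply: sup_upper_bound; last by exists y.
exact: has_sup_phi_conj.
Qed.

Lemma phi_conj_nat_le (j : nat) : phiM' j%:R <= ln (M j).
Proof.
apply: ge_sup => [|_ [y _ <-]].
  by exists (j%:R * 0 - phiM 0), 0 => /=.
by have := phi_assoc_ge j y; lra.
Qed.

End AssociatedWeight.

Lemma phi_conj_le {R : realType} (w : R -> R) (x b : R) :
  (forall y, 0 <= y -> x * y - phi w y <= b) -> phi_conj w x <= b.
Proof.
move=> Hb; apply: ge_sup => [|_ [y y0 <-]]; last exact: Hb.
by exists (x * 0 - phi w 0), 0 => /=.
Qed.

Lemma alpha_ratio_le (R : realType) (N M : nat -> R) (q k : R) (j : nat) :
  0 < q -> (0 < j)%N ->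
  (alpha_ratio N M q j <= expR k) =
  (phi_conj (assoc_weight M) (j%:R * q) <=
     q * phi_conj (assoc_weight N) j%:R + j%:R * q * k).
Proof.
move=> q0 j0; rewrite /alpha_ratio -expRN -expRD ler_expR.
have jR : 0 < j%:R :> R by rewrite ltr0n.
have jq : 0 < j%:R * q by rewrite mulr_gt0.
rewrite -(ler_pM2l jq) mulrBr mulVKf ?gt_eqF// lerBlDr addrC.
by congr (_ <= _ + _); field; rewrite ?gt_eqF.
Qed.

(** * Conjugate duality between the two inequalities *)

Section Duality.
Context {R : realType} {M N : nat -> R}.
Hypotheses (LM : is_LC M) (LN : is_LC N).
Local Notation phiM := (phi (assoc_weight M)).
Local Notation phiN := (phi (assoc_weight N)).
Local Notation phiM' := (phi_conj (assoc_weight M)).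
Local Notation phiN' := (phi_conj (assoc_weight N)).

(** For j >= J, q (j y - log N_j) <= q j y - q phi_N^* (j) <= jq (k + y) - phi_M^* (jq) <= phi_M (k
    + y). The terms with j >= J suffice because y >= log N_J. *)
Lemma phi_ge_of_phi_conj_le (q k : R) (J : nat) : 0 < q -> 0 <= k ->
  (forall j, (J <= j)%N -> phiM' (j%:R * q) <= q * phiN' j%:R + j%:R * q * k) ->
  forall y, 0 <= y -> ln (N J) <= y -> q * phiN y <= phiM (k + y).
Proof.
move=> q0 k0 HJ y y0 Jy.
rewrite -ler_pdivlMl//; apply: (phi_assoc_le_tail LN _ _ _ y0 Jy) => j Jj.
rewrite ler_pdivlMl//.
have jq0 : 0 <= j%:R * q by rewrite mulr_ge0 ?ler0n ?ltW.
have := young_phi_conj LM _ _ jq0 (addr_ge0 k0 y0).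
have := HJ j Jj.
have := phi_conj_nat_le LN j; rewrite -(ler_pM2l q0).
nra.
Qed.

(** For y >= Y + k the hypothesis at y - k gives jqy - phi_M (y) <= q (j (y - k) - phi_N (y - k)) +
    jqk, and Young's inequality bounds the bracket by phi_N^* (j). *)
Lemma phi_conj_le_of_phi_ge (q k Y : R) : 0 < q -> 0 <= k -> 0 <= Y ->
  (forall y, Y <= y -> q * phiN y <= phiM (k + y)) ->
  (\forall j \near \oo,
     phiM' (j%:R * q) <= q * phiN' j%:R + j%:R * q * k)%classic.
Proof.
move=> q0 k0 Y0 HY.
(* This threshold forces j >= phi_N (Y + 1), hence j Y <= j (Y + 1) - phi_N (Y + 1) <= phi_N^*
   (j). *)
exists (Num.truncn `|phiN (Y + 1)|).+1 => // j /= Jj.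
have jR : 0 <= j%:R :> R by rewrite ler0n.
have jq0 : 0 <= j%:R * q by rewrite mulr_ge0// ltW.
apply: phi_conj_le => y y0.
have [Yky|yYk] := leP (Y + k) y.
  have Yyk : Y <= y - k by lra.
  have := HY _ Yyk; rewrite subrKC.
  have := young_phi_conj LN _ _ jR (le_trans Y0 Yyk); rewrite -(ler_pM2l q0).
  nra.
(* The range [y < Y + k] only matters through
   [phi_M >= 0] and the superlinear growth of [phi_N^*]. *)
have phiy : 0 <= phiM y.
  by apply: le_trans (phi_assoc_ge LM 0 y); rewrite (LC_M0 LM) ln1; lra.
have Y1 : 0 <= Y + 1 by lra.
have jphi : phiN (Y + 1) <= j%:R.
  apply: le_trans (ler_norm _) (ltW (lt_le_trans (truncnS_gt _) _)).
  by rewrite ler_nat.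
have : j%:R * Y <= phiN' j%:R.
  by have := young_phi_conj LN _ _ jR Y1; lra.
rewrite -(ler_pM2l q0) => qjY.
have := ler_wpM2l jq0 (ltW yYk); nra.
Qed.

End Duality.

(** * From admissible exponents of one index to those of the other *)

Lemma beta_admissible (R : realType) (M N : nat -> R) (q a b : R) :
  is_LC M -> is_LC N -> 1 < q -> 0 < a -> b < a^-1 ->
  (limn_esup (fun j => (alpha_ratio N M q j)%:E) < (q `^ a)%:E)%E ->
  exists K : R, 1 < K /\
    ((K `^ b)%:E < limf_einf (fun t : R =>
       (assoc_weight M (K * t) / assoc_weight N t)%:E) +oo%R)%E.
Proof.
move=> LM LN q1 a0 ba /near_limf_esup_lt[J _ HJ].
have q0 : 0 < q by lra.
have lnq : 0 < ln q by rewrite ln_gt0.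
(* Here K = e^k = q^a. The lower limit will be at least q, and q > q^(ab) = K^b because ab < 1. *)
pose k := a * ln q; have k0 : 0 < k by rewrite mulr_gt0.
exists (expR k); split; first by rewrite expR_gt1.
have -> : expR k `^ b = expR (b * k).
  by rewrite /powR gt_eqF ?expR_gt0// expRK.
apply: (@lt_le_trans _ _ q%:E).
  rewrite lte_fin -[ltRHS]lnK ?posrE// ltr_expR /k mulrA.
  by rewrite gtr_pMl// -ltr_pdivlMr// div1r.
apply: limf_einf_ge_near; apply/near_pinfty_expR.
(* Starting at [J.+1] keeps j positive, as [alpha_ratio_le] requires. *)
have Hk j : (J.+1 <= j)%N -> phi_conj (assoc_weight M) (j%:R * q) <=
    q * phi_conj (assoc_weight N) j%:R + j%:R * q * k.
  move=> Jj; rewrite -alpha_ratio_le//; last exact: leq_trans Jj.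
  have := HJ j (ltnW Jj); rewrite /= lte_fin => /ltW.
  by rewrite /powR gt_eqF.
(* Past this threshold y >= 0, y >= log N_{J+1} and phi_N (y) > 0. *)
exists (`|ln (N 1%N)| + `|ln (N J.+1)| + 1); first by rewrite !addr_ge0.
move=> y Yy.
have := ler_norm (ln (N 1%N)); have := ler_norm (ln (N J.+1)).
have := normr_ge0 (ln (N 1%N)); have := normr_ge0 (ln (N J.+1)).
move=> ? ? ? ?.
have phiNy : 0 < phi (assoc_weight N) y by apply: phi_assoc_gt0 => //; lra.
rewrite lee_fin -expRD ler_pdivlMr//.
apply: (phi_ge_of_phi_conj_le LM LN _ _ _ q0 (ltW k0) Hk); lra.
Qed.

Lemma alpha_admissible (R : realType) (M N : nat -> R) (K a b : R) :
  is_LC M -> is_LC N -> 1 < K -> 0 < b -> b^-1 < a ->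
  ((K `^ b)%:E < limf_einf (fun t : R =>
       (assoc_weight M (K * t) / assoc_weight N t)%:E) +oo%R)%E ->
  exists q : R, 1 < q /\
    (limn_esup (fun j => (alpha_ratio N M q j)%:E) < (q `^ a)%:E)%E.
Proof.
move=> LM LN K1 b0 ba /near_lt_limf_einf/near_pinfty_expR[Y Y0 HY].
have K0 : 0 < K by lra.
pose k := ln K; have k0 : 0 < k by rewrite ln_gt0.
have KbE : K `^ b = expR (b * k) by rewrite /powR gt_eqF.
(* With q = K^b the upper limit is at most K = q^(1/b) < q^a, because ab > 1. *)
pose q := expR (b * k).
have q1 : 1 < q by rewrite expR_gt1 mulr_gt0.
have q0 : 0 < q by rewrite expR_gt0.
exists q; split=> //.
apply: (@le_lt_trans _ _ (expR k)%:E); last first.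
  rewrite lte_fin /powR gt_eqF// expRK ltr_expR mulrA.
  by rewrite ltr_pMl// -ltr_pdivrMr// div1r.
pose Y' := Num.max Y (`|ln (N 1%N)| + 1).
have HY' y : Y' <= y ->
    q * phi (assoc_weight N) y <= phi (assoc_weight M) (k + y).
  rewrite ge_max => /andP[Yy Ny].
  have phiNy : 0 < phi (assoc_weight N) y.
    by apply: phi_assoc_gt0 => //; have := ler_norm (ln (N 1%N)); lra.
  have := HY y Yy; rewrite lte_fin ltr_pdivlMr// KbE => /ltW.
  by rewrite /phi expRD /k lnK ?posrE.
have Y'0 : 0 <= Y' by rewrite le_max Y0.
have := phi_conj_le_of_phi_ge LM LN _ _ _ q0 (ltW k0) Y'0 HY'.
move=> [J _ HJ]; apply: limf_esup_le_near; exists J.+1 => // j /= Jj.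
rewrite lee_fin alpha_ratio_le//; last exact: leq_trans Jj.
by apply: HJ; exact: ltnW.
Qed.

Theorem proposition4p2 (R : realType) (M N : nat -> R)
    (hM : is_LC M) (hN : is_LC N) (hMN : forall j : nat, M j <= N j) :
  alpha_index N M = ((beta_index (assoc_weight N) (assoc_weight M))^-1)%E.
Proof.
rewrite /alpha_index /beta_index.
set SA := [set a%:E | a in _]%classic; set SB := [set b%:E | b in _]%classic.
have alpha0 : (0 <= ereal_inf SA)%E.
  by apply: le_ereal_inf_tmp => _ [a [a0 _] <-]; rewrite lee_fin ltW.
have beta0 : (0 <= maxe 0 (ereal_sup SB))%E by rewrite le_max lexx.
apply/eqP; rewrite eq_le; apply/andP; split.
  (* Inversion reverses the order on [0, +oo], with 1/0 = +oo. So it suffices that alpha <= 1/b for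
     each b admissible for beta, and every 1/b + e with e > 0 is admissible for alpha. *)
  rewrite -lee_pV2 ?inE ?inve_ge0// inveK ge_max inve_ge0 alpha0/=.
  apply: ge_ereal_sup => _ [b [b0 [K [K1 HK]]] <-].
  rewrite -[leLHS]inveK lee_pV2 ?inE ?inve_ge0 ?lee_fin ?(ltW b0)//.
  rewrite inver gt_eqF//; apply/lee_addgt0Pr => e e0.
  apply: ereal_inf_lbound; exists (b^-1 + e) => //; split.
    by rewrite addr_gt0 ?invr_gt0.
  by apply: alpha_admissible HK => //; rewrite ltrDl.
(* Conversely, if a is admissible for alpha, then every positive b < 1/a is admissible for beta, so
   the supremum is at least 1/a. *)
apply: le_ereal_inf_tmp => _ [a [a0 [q [q1 Hq]]] <-].
rewrite -lee_pV2 ?inE ?inve_ge0 ?lee_fin ?(ltW a0)// inveK.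
rewrite inver gt_eqF// le_max; apply/orP; right.
apply/lee_subgt0Pr => e e0; rewrite -EFinB.
(* Taking the maximum with [a^-1 / 2] keeps the exponent positive. *)
pose b := Num.max (a^-1 - e) (a^-1 / 2).
have aV0 : 0 < a^-1 by rewrite invr_gt0.
have b0 : 0 < b by rewrite lt_max divr_gt0 ?orbT.
have ba : b < a^-1 by rewrite gt_max; apply/andP; split; lra.
apply: (@le_trans _ _ b%:E); first by rewrite lee_fin le_max lexx.
apply: ereal_sup_ubound; exists b => //; split=> //.
exact: beta_admissible ba Hq.
Qed.
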